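(* Let $(S,+,\ast)$ be an Ehresmann semigroupoid, and let $C(S)$ be its associated local biordered Ehresmann category. Then $(S,+,\ast)$ is a restriction semigroupoid if and only if $C(S)$ is a locally inductive category.
   Context: **Semigroupoid.** A semigroupoid is a triple $(S,S^{(2)},\star)$ with $S$ a set, $S^{(2)}\subseteq S\times S$ and $\star\colon S^{(2)}\to S$ such that for all $s,t,r\in S$: if either ($(s,t),(t,r)\in S^{(2)}$), or ($(s,t),(s\star t,r)\in S^{(2)}$), or ($(t,r),(s,t\star r)\in S^{(2)}$), then all of $(s,t),(t,r),(s\star t,r),(s,t\star r)$ lie in $S^{(2)}$ and $(s\star t)\star r=s\star(t\star r)$. Write $st=s\star t$; ''$st$ is defined'' means $(s,t)\in S^{(2)}$. **Ehresmann semigroupoid (two-sided).** A triple $(S,+,\ast)$ with $S$ a semigroupoid and unary operations $s\mapsto s^+$, $s\mapsto s^\ast$ on $S$ such that for all $s,t\in S$: (i) $s^+s$ and $ss^\ast$ are defined, $s^+s=s$ and $ss^\ast=s$; (ii) if $s^+t^+$ is defined, then $t^+s^+$ is defined and $s^+t^+=t^+s^+$; if $s^\ast t^\ast$ is defined, then $t^\ast s^\ast$ is defined and $s^\ast t^\ast=t^\ast s^\ast$; (iii) if $s^+t^+$ is defined, then $s^+t^+=(s^+t)^+$; if $s^\ast t^\ast$ is defined, then $s^\ast t^\ast=(st^\ast)^\ast$; (iv) if $st$ is defined, then $(st)^+=(st^+)^+$ and $(st)^\ast=(s^\ast t)^\ast$; (v) $s^+=(s^+)^\ast$ and $s^\ast=(s^\ast)^+$.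 (The products on the right-hand sides in (iii), (iv) are automatically defined.) Its set of projections is $U=\{s^+:s\in S\}=\{s^\ast:s\in S\}$. **Restriction semigroupoid (two-sided).** A triple $(S,+,\ast)$ satisfying (i), (ii), (iii), (v) above and, instead of (iv): if $st$ is defined, then $st^+=(st)^+s$ and $s^\ast t=t(st)^\ast$. Every restriction semigroupoid is an Ehresmann semigroupoid. **Category.** A (small) category consists of sets $\mathcal{C}_0\subseteq\mathcal{C}$, maps $D,R\colon\mathcal{C}\to\mathcal{C}_0$ and a partial operation $\circ$ on $\mathcal{C}$, with $x\circ y$ defined iff $D(x)=R(y)$, such that: $D(x\circ y)=D(y)$ and $R(x\circ y)=R(x)$; $\circ$ is associative on composable triples; for $e\in\mathcal{C}_0$, $D(e)=e=R(e)$, and $x\circ e=x$, $e\circ y=y$ whenever $D(x)=e=R(y)$. **Local meet-semilattice.** A semigroupoid $X$ such that for every $e\in X$, $ee$ is defined and $ee=e$, and whenever $ef$ is defined, $fe$ is defined and $ef=fe$. Its partial order is: $e\leq f$ iff $ef$ is defined and $ef=e$. The operation is denoted $\wedge$ and is determined by $\leq$; a poset $(X,\le)$ is called a local meet-semilattice if $\le$ arises this way. **Ordered category.** $(\mathcal{C},\leq)$ with $\mathcal{C}$ a category and $\leq$ a partial order on $\mathcal{C}$ such that: $x\leq y$ implies $D(x)\leq D(y)$ and $R(x)\leq R(y)$; if $x\leq y$, $x'\leq y'$ and $x\circ x'$, $y\circ y'$ are defined, then $x\circ x'\leq y\circ y'$. It has restrictions if for each $x\in\mathcal{C}$ and $e\in\mathcal{C}_0$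 with $e\leq D(x)$ there is a unique $x|e\in\mathcal{C}$ with $x|e\leq x$ and $D(x|e)=e$. It has corestrictions if for each $x\in\mathcal{C}$ and $e\in\mathcal{C}_0$ with $e\leq R(x)$ there is a unique $e|x\in\mathcal{C}$ with $e|x\leq x$ and $R(e|x)=e$. **Locally inductive category.** A pair $(\mathcal{C},\leq)$ which is an ordered category with restrictions and corestrictions such that $\mathcal{C}_0$ is a local meet-semilattice with partial order (the restriction of) $\leq$. **Construction $C(S)$.** For an Ehresmann semigroupoid $(S,+,\ast)$ with projections $U$: $C(S)=S$ as a set, $C(S)_0=U$, $D(s)=s^\ast$, $R(s)=s^+$, $s\cdot t=st$ defined exactly when $s^\ast=t^+$; it carries two partial orders: $s\leq_l t$ iff $s^+t$ is defined and $s^+t=s$; $s\leq_r t$ iff $ts^\ast$ is defined and $ts^\ast=s$. **Convention.** A locally inductive category $(\mathcal{C},\leq)$ is identified with the biordered category $(\mathcal{C},\leq,\leq)$. Thus ''$C(S)$ is a locally inductive category'' means that $\leq_l=\leq_r$ on $C(S)$ and that $C(S)$ with this common order is a locally inductive category. *)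

(* Defs.v *)
From Stdlib Require Import Relations.

Set Implicit Arguments.
Unset Strict Implicit.
Unset Printing Implicit Defensive.

(* A partial binary operation is its domain together with a total function.
   The value of [mul] outside [defined] is arbitrary; below it is only used at
   pairs that are in the domain, by hypothesis or as a consequence of the
   axioms (see the [*_defined] lemmas). *)
Record partial_op (X : Type) := PartialOp {
  defined : X -> X -> Prop;
  mul : X -> X -> X
}.

Definition is_semigroupoid (X : Type) (op : partial_op X) : Prop :=
  forall s t r : X,
    (defined op s t /\ defined op t r) \/
    (defined op s t /\ defined op (mul op s t) r) \/
    (defined op t r /\ defined op s (mul op t r)) ->
    defined op s t /\ defined op t r /\
    defined op (mul op s t) r /\ defined op s (mul op t r) /\
    mul op (mul op s t) r = mul op s (mul op t r).

Record semigroupoid := Semigroupoid {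
  carrier :> Type;
  sop : partial_op carrier;
  semigroupoidP : is_semigroupoid sop
}.

Notation sdef := (defined (sop _)).
Notation "s ** t" := (mul (sop _) s t) (at level 40, left associativity).

Section UnarySemigroupoids.

Variables (S : semigroupoid) (plus star : S -> S).
Local Notation "s ^+" := (plus s) (at level 1, format "s ^+").
Local Notation "s ^*" := (star s) (at level 1, format "s ^*").

Definition axiom_i : Prop :=
  forall s : S, (sdef s^+ s /\ s^+ ** s = s) /\ (sdef s s^* /\ s ** s^* = s).

Definition axiom_ii : Prop :=
  forall s t : S,
    (sdef s^+ t^+ -> sdef t^+ s^+ /\ s^+ ** t^+ = t^+ ** s^+) /\
    (sdef s^* t^* -> sdef t^* s^* /\ s^* ** t^* = t^* ** s^*).

Definition axiom_iii : Prop :=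
  forall s t : S,
    (sdef s^+ t^+ -> s^+ ** t^+ = (s^+ ** t)^+) /\
    (sdef s^* t^* -> s^* ** t^* = (s ** t^*)^*).

Definition axiom_iv : Prop :=
  forall s t : S, sdef s t ->
    (s ** t)^+ = (s ** t^+)^+ /\ (s ** t)^* = (s^* ** t)^*.

Definition axiom_v : Prop :=
  forall s : S, s^+ = (s^+)^* /\ s^* = (s^*)^+.

Definition restriction_axiom : Prop :=
  forall s t : S, sdef s t ->
    s ** t^+ = (s ** t)^+ ** s /\ s^* ** t = t ** (s ** t)^*.

Definition is_ehresmann : Prop :=
  axiom_i /\ axiom_ii /\ axiom_iii /\ axiom_iv /\ axiom_v.

Definition is_restriction : Prop :=
  axiom_i /\ axiom_ii /\ axiom_iii /\ restriction_axiom /\ axiom_v.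

Lemma axiom_iii_defined (s t : S) : axiom_i ->
  (sdef s^+ t^+ -> sdef s^+ t) /\ (sdef s^* t^* -> sdef s t^*).
Proof.
intros Hi; split; intros H.
- destruct (Hi t) as [[d e] _].
  destruct (semigroupoidP (or_introl (conj H d))) as (_ & _ & _ & K & _).
  now rewrite e in K.
- destruct (Hi s) as [_ [d e]].
  destruct (semigroupoidP (or_introl (conj d H))) as (_ & _ & K & _ & _).
  now rewrite e in K.
Qed.

Lemma axiom_iv_defined (s t : S) : axiom_i -> sdef s t ->
  sdef s t^+ /\ sdef s^* t.
Proof.
intros Hi H; split.
- destruct (Hi t) as [[d e] _].
  assert (H' : sdef s (t^+ ** t)) by now rewrite e.
  now destruct (semigroupoidP (or_intror (or_intror (conj d H')))).
- destruct (Hi s) as [_ [d e]].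
  assert (H' : sdef (s ** s^*) t) by now rewrite e.
  now destruct (semigroupoidP (or_intror (or_introl (conj d H')))) as (_ & K & _).
Qed.

Lemma restriction_axiom_defined (s t : S) : axiom_i -> sdef s t ->
  sdef (s ** t)^+ s /\ sdef t (s ** t)^*.
Proof.
intros Hi H; destruct (Hi (s ** t)) as [[d _] [d' _]]; split.
- now destruct (semigroupoidP (or_intror (or_intror (conj H d)))).
- now destruct (semigroupoidP (or_intror (or_introl (conj H d')))) as (_ & K & _).
Qed.

(* By [axiom_v], this is also the image of [star]. *)
Definition projection (u : S) : Prop := exists s : S, u = s^+.

End UnarySemigroupoids.

Record cat_data := CatData {
  mor : Type;
  ob : mor -> Prop;
  D : mor -> mor;
  R : mor -> mor;
  comp : partial_op mor
}.

Definition is_category (C : cat_data) : Prop :=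
  let cdef := defined (@comp C) in
  let c := mul (@comp C) in
  (forall x : mor C, ob (D x) /\ ob (R x)) /\
  (forall x y : mor C, cdef x y <-> D x = R y) /\
  (forall x y : mor C, cdef x y -> D (c x y) = D y /\ R (c x y) = R x) /\
  (forall x y z : mor C, cdef x y -> cdef y z -> c (c x y) z = c x (c y z)) /\
  (forall e : mor C, ob e -> D e = e /\ e = R e) /\
  (forall e x y : mor C, ob e -> D x = e -> e = R y -> c x e = x /\ c e y = y).

Definition is_local_meet_semilattice (X : Type) (meet : partial_op X) : Prop :=
  is_semigroupoid meet /\
  (forall e : X, defined meet e e /\ mul meet e e = e) /\
  (forall e f : X, defined meet e f ->
     defined meet f e /\ mul meet e f = mul meet f e).

Definition meet_le (X : Type) (meet : partial_op X) : relation X :=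
  fun e f => defined meet e f /\ mul meet e f = e.

Definition poset_is_local_meet_semilattice (X : Type) (le : relation X) : Prop :=
  exists meet : partial_op X,
    is_local_meet_semilattice meet /\ same_relation X le (meet_le meet).

Section OrderedCategories.

Variables (C : cat_data) (le : relation (mor C)).

Definition is_ordered_category : Prop :=
  is_category C /\ order (mor C) le /\
  (forall x y, le x y -> le (D x) (D y) /\ le (R x) (R y)) /\
  (forall x y x' y', le x y -> le x' y' ->
     defined (@comp C) x x' -> defined (@comp C) y y' ->
     le (mul (@comp C) x x') (mul (@comp C) y y')).

Definition has_restrictions : Prop :=
  forall x e : mor C, ob e -> le e (D x) -> exists! z, le z x /\ D z = e.

Definition has_corestrictions : Prop :=
  forall x e : mor C, ob e -> le e (R x) -> exists! z, le z x /\ R z = e.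

Definition is_locally_inductive : Prop :=
  is_ordered_category /\ has_restrictions /\ has_corestrictions /\
  @poset_is_local_meet_semilattice {e : mor C | ob e}
    (fun e f => le (proj1_sig e) (proj1_sig f)).

End OrderedCategories.

(* A locally inductive category (C, le) is identified with the biordered
   category (C, le, le). *)
Definition is_locally_inductive2 (C : cat_data) (le_l le_r : relation (mor C))
  : Prop :=
  same_relation (mor C) le_l le_r /\ is_locally_inductive le_l.

Section ConstructionC.

Variables (S : semigroupoid) (plus star : S -> S).

Definition C_cat : cat_data :=
  {| mor := S;
     ob := projection plus;
     D := star;
     R := plus;
     comp := {| defined := fun s t => star s = plus t;
                mul := fun s t => s ** t |} |}.

Definition C_le_l : relation (mor C_cat) :=
  fun s t : S => sdef (plus s) t /\ plus s ** t = s.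

Definition C_le_r : relation (mor C_cat) :=
  fun s t : S => sdef t (star s) /\ t ** star s = s.

Lemma C_cat_defined (s t : S) : is_ehresmann plus star ->
  defined (@comp C_cat) s t -> sdef s t.
Proof.
intros [Hi _] H; simpl in H.
destruct (Hi s) as [_ [d e]]; destruct (Hi t) as [[d' _] _].
rewrite <- H in d'.
destruct (semigroupoidP (or_introl (conj d d'))) as (_ & _ & K & _ & _).
now rewrite e in K.
Qed.

End ConstructionC.

Arguments is_locally_inductive2 C le_l le_r : clear implicits.
Arguments C_cat [S] plus star.
Arguments C_le_l [S] plus star.
Arguments C_le_r [S] plus star.

(* Main.v *)
Require Import Defs.
From Stdlib Require Import Relations ProofIrrelevance.

(** In an Ehresmann semigroupoid the left order [s = s^+ t] says that [s] is
    obtained from [t] by multiplying by a projection on the left, the right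
    order that it is obtained by multiplying by a projection on the right
    ([C_le_l_proj_mul], [C_le_r_mul_proj]).  The restriction axiom is the rule
    for moving a projection across an element: [s t^+ = (s t)^+ s] and
    [s^* t = t (s t)^*].  Hence it holds exactly when the two orders coincide
    ([restriction_axiom_iff_orders_coincide]): applied to [s^+ t] it rewrites
    this element as [t s^*]; conversely [s t^+] lies below [s] in the right
    order, and if it also lies below [s] in the left order then
    [s t^+ = (s t^+)^+ s = (s t)^+ s] by axiom (iv).

    Coincidence of the orders is also all that local inductivity asks for
    ([locally_inductive_of_orders_coincide]).  In any Ehresmann semigroupoid
    [C_le_l] is an order that is compatible with composition and with the
    codomain map [plus], and [plus x = e] with [x] below [y] forces [x = e y],
    which is the corestriction.  The domain map [star] and restrictions behave
    in the same way with respect to [C_le_r], and the two halves fit together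
    as soon as the orders are equal. *)

Section Products.

Set Implicit Arguments.
Unset Strict Implicit.

Variable S : semigroupoid.
Implicit Types s t r : S.

Lemma mul_assoc s t r : sdef s t -> sdef t r ->
  sdef (s ** t) r /\ sdef s (t ** r) /\ (s ** t) ** r = s ** (t ** r).
Proof.
intros H K.
now destruct (semigroupoidP (or_introl (conj H K))) as (_ & _ & ? & ? & ?).
Qed.

Lemma sdef_mull s t r : sdef s t -> sdef (s ** t) r -> sdef t r.
Proof.
intros H K.
now destruct (semigroupoidP (or_intror (or_introl (conj H K))))
  as (_ & ? & _).
Qed.

Lemma sdef_mulr s t r : sdef t r -> sdef s (t ** r) -> sdef s t.
Proof.
intros H K.
now destruct (semigroupoidP (or_intror (or_intror (conj H K)))).
Qed.

End Products.

Section Ehresmann.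

Set Implicit Arguments.
Unset Strict Implicit.

Variables (S : semigroupoid) (plus star : S -> S).
Hypothesis HE : is_ehresmann plus star.
Implicit Types s t u v : S.
Local Notation "s ^+" := (plus s) (at level 1, format "s ^+").
Local Notation "s ^*" := (star s) (at level 1, format "s ^*").
Local Notation proj := (projection plus).
Local Notation le_l := (C_le_l plus star).
Local Notation le_r := (C_le_r plus star).

Lemma plus_mul s : sdef s^+ s /\ s^+ ** s = s.
Proof. now destruct HE as (Hi & _); apply Hi. Qed.

Lemma mul_star s : sdef s s^* /\ s ** s^* = s.
Proof. now destruct HE as (Hi & _); apply Hi. Qed.

Lemma proj_plus s : proj s^+.
Proof. now exists s. Qed.

Lemma proj_star s : proj s^*.
Proof. destruct HE as (_ & _ & _ & _ & Hv); exists s^*; apply Hv. Qed.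

Lemma star_proj u : proj u -> u^* = u.
Proof.
destruct HE as (_ & _ & _ & _ & Hv); intros [s ->].
symmetry; apply Hv.
Qed.

Lemma plus_proj u : proj u -> u^+ = u.
Proof.
intros pu; destruct HE as (_ & _ & _ & _ & Hv).
generalize (proj2 (Hv u)); rewrite (star_proj pu); intros K; now symmetry.
Qed.

Lemma proj_idem u : proj u -> sdef u u /\ u ** u = u.
Proof. intros pu; generalize (plus_mul u); now rewrite (plus_proj pu). Qed.

Lemma proj_comm u v : proj u -> proj v -> sdef u v ->
  sdef v u /\ u ** v = v ** u.
Proof.
intros pu pv; destruct HE as (_ & Hii & _).
generalize (proj1 (Hii u v)); now rewrite (plus_proj pu), (plus_proj pv).
Qed.

Lemma sdef_plus_r s t : sdef s t <-> sdef s t^+.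
Proof.
destruct (plus_mul t) as [d e]; split; intros H.
- now apply (sdef_mulr d); rewrite e.
- destruct (mul_assoc H d) as (_ & K & _); now rewrite e in K.
Qed.

Lemma sdef_star_l s t : sdef s t <-> sdef s^* t.
Proof.
destruct (mul_star s) as [d e]; split; intros H.
- now apply (sdef_mull d); rewrite e.
- destruct (mul_assoc d H) as (K & _); now rewrite e in K.
Qed.

Lemma plus_proj_mul u t : proj u -> sdef u t -> (u ** t)^+ = u ** t^+.
Proof.
intros pu H; destruct HE as (_ & _ & Hiii & _).
generalize (proj1 (Hiii u t)); rewrite (plus_proj pu).
intros K; symmetry; apply K; now apply -> sdef_plus_r.
Qed.

Lemma star_mul_proj s u : proj u -> sdef s u -> (s ** u)^* = s^* ** u.
Proof.
intros pu H; destruct HE as (_ & _ & Hiii & _).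
generalize (proj2 (Hiii s u)); rewrite (star_proj pu).
intros K; symmetry; apply K; now apply -> sdef_star_l.
Qed.

Lemma proj_mul u v : proj u -> proj v -> sdef u v -> proj (u ** v).
Proof.
intros pu pv H; exists (u ** v).
now rewrite (plus_proj_mul pu H), (plus_proj pv).
Qed.

Lemma C_le_l_proj_mul u t : proj u -> sdef u t -> le_l (u ** t) t.
Proof.
intros pu H; unfold C_le_l; rewrite (plus_proj_mul pu H).
destruct (plus_mul t) as [d e].
destruct (mul_assoc (proj1 (sdef_plus_r u t) H) d) as (? & _ & K).
split; [assumption | now rewrite K, e].
Qed.

Lemma C_le_r_mul_proj s u : proj u -> sdef s u -> le_r (s ** u) s.
Proof.
intros pu H; unfold C_le_r; rewrite (star_mul_proj pu H).
destruct (mul_star s) as [d e].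
destruct (mul_assoc d (proj1 (sdef_star_l s u) H)) as (_ & ? & K).
split; [assumption | now rewrite <- K, e].
Qed.

(** * The restriction axiom and the two orders *)

Lemma restriction_axiom_iff_orders_coincide :
  restriction_axiom plus star <-> same_relation S le_l le_r.
Proof.
destruct HE as (Hi & _ & _ & Hiv & _); split.
- intros Hr; split; intros s t [d e].
  + destruct (Hr _ _ d) as [_ K].
    destruct (restriction_axiom_defined Hi d) as [_ d'].
    rewrite (star_proj (proj_plus s)), e in K; rewrite e in d'.
    now split.
  + destruct (Hr _ _ d) as [K _].
    destruct (restriction_axiom_defined Hi d) as [d' _].
    rewrite (plus_proj (proj_star s)), e in K; rewrite e in d'.
    now split.
- intros [lr rl] s t H; destruct (Hiv _ _ H) as [-> ->]; split.
  + assert (K : le_r (s ** t^+) s).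
    { apply (C_le_r_mul_proj (proj_plus t)); now apply -> sdef_plus_r. }
    symmetry; apply (rl _ _ K).
  + assert (K : le_l (s^* ** t) t).
    { apply (C_le_l_proj_mul (proj_star s)); now apply -> sdef_star_l. }
    symmetry; apply (lr _ _ K).
Qed.

(** * The ordered category of an Ehresmann semigroupoid *)

Lemma C_cat_category : is_category (C_cat plus star).
Proof.
assert (Hd := fun s t => C_cat_defined (s := s) (t := t) HE).
destruct HE as (_ & _ & _ & Hiv & _).
repeat split; simpl in *.
- apply proj_star.
- apply proj_plus.
- easy.
- easy.
- rewrite (proj2 (Hiv _ _ (Hd _ _ H))), H; f_equal; apply plus_mul.
- rewrite (proj1 (Hiv _ _ (Hd _ _ H))), <- H; f_equal; apply mul_star.
- intros x y z Hxy Hyz; apply mul_assoc; auto.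
- now apply star_proj.
- symmetry; now apply plus_proj.
- rewrite <- H0; apply mul_star.
- rewrite H1; apply plus_mul.
Qed.

Lemma C_le_l_plus s t : le_l s t -> le_l s^+ t^+.
Proof.
intros [d e]; unfold C_le_l; rewrite (plus_proj (proj_plus s)); split.
- now apply sdef_plus_r in d.
- now rewrite <- (plus_proj_mul (proj_plus s) d), e.
Qed.

Lemma C_le_r_star s t : le_r s t -> le_r s^* t^*.
Proof.
intros [d e]; unfold C_le_r; rewrite (star_proj (proj_star s)); split.
- now apply sdef_star_l in d.
- now rewrite <- (star_mul_proj (proj_star s) d), e.
Qed.

Lemma C_le_l_order : order S le_l.
Proof.
split.
- exact plus_mul.
- intros s t r [d e] [d' e']; unfold C_le_l.
  assert (p : sdef s^+ t^+) by now apply -> sdef_plus_r.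
  destruct (mul_assoc p d') as (Hd & _ & K).
  rewrite e', e, <- (plus_proj_mul (proj_plus s) d), e in K.
  rewrite <- (plus_proj_mul (proj_plus s) d), e in Hd.
  now split.
- intros s t Hst Hts.
  assert (E : s^+ = t^+).
  { destruct (C_le_l_plus Hst) as [d e], (C_le_l_plus Hts) as [_ e'].
    rewrite (plus_proj (proj_plus s)) in d, e.
    rewrite (plus_proj (proj_plus t)) in e'.
    destruct (proj_comm (proj_plus s) (proj_plus t) d) as [_ K]; congruence. }
  destruct Hst as [_ e]; rewrite <- e, E; apply plus_mul.
Qed.

(** For composable [x, x'] one has [(x x')^+ = x^+] and
    [x x' = x (x^* y') = x y' = x^+ (y y')]. *)
Lemma C_le_l_mul x y x' y' : le_l x y -> le_l x' y' ->
  x^* = x'^+ -> y^* = y'^+ -> le_l (x ** x') (y ** y').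
Proof.
intros [d e] [d' e'] H H'.
assert (Dx : sdef x x') by now apply (C_cat_defined HE).
assert (Dy : sdef y y') by now apply (C_cat_defined HE).
assert (P : (x ** x')^+ = x^+) by now apply C_cat_category.
rewrite <- H in d', e'.
destruct (mul_star x) as [dx ex].
destruct (mul_assoc dx d') as (_ & _ & A); rewrite ex, e' in A.
destruct (mul_assoc d Dy) as (_ & Hd & B); rewrite e in B.
unfold C_le_l; rewrite P; split; [assumption | congruence].
Qed.

Lemma C_cat_has_corestrictions : @has_corestrictions (C_cat plus star) le_l.
Proof.
intros x e pe [d E]; simpl in x, e, pe, d, E.
rewrite (plus_proj pe) in d, E.
assert (H : sdef e x) by now apply sdef_plus_r.
exists (e ** x); split; [split|].
- now apply C_le_l_proj_mul.
- simpl; now rewrite (plus_proj_mul pe H).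
- intros z [[_ Hz] <-]; exact Hz.
Qed.

Lemma C_cat_has_restrictions : @has_restrictions (C_cat plus star) le_r.
Proof.
intros x e pe [d E]; simpl in x, e, pe, d, E.
rewrite (star_proj pe) in d, E.
assert (H : sdef x e) by now apply sdef_star_l.
exists (x ** e); split; [split|].
- now apply C_le_r_mul_proj.
- simpl; now rewrite (star_mul_proj pe H).
- intros z [[_ Hz] <-]; exact Hz.
Qed.

(** * The local meet-semilattice of projections *)

(** When [u ** v] is defined, it is a projection and so equals [(u ** v)^+];
    the latter is a projection for all [u, v], hence gives a total function. *)
Definition proj_meet : partial_op {u : S | proj u} :=
  {| defined := fun p q => sdef (proj1_sig p) (proj1_sig q);
     mul := fun p q => exist _ (proj1_sig p ** proj1_sig q)^+ (proj_plus _) |}.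

Lemma proj_sig_ext (u v : {u : S | proj u}) :
  proj1_sig u = proj1_sig v -> u = v.
Proof.
destruct u as [u pu], v as [v pv]; apply subset_eq_compat.
Qed.

Lemma proj_meetE (u v : {u : S | proj u}) : defined proj_meet u v ->
  proj1_sig (mul proj_meet u v) = proj1_sig u ** proj1_sig v.
Proof.
destruct u as [u pu], v as [v pv]; simpl; intros H.
now apply plus_proj, proj_mul.
Qed.

Lemma proj_meet_semigroupoid : is_semigroupoid proj_meet.
Proof.
intros u v w H.
(* Both other forms of the hypothesis reduce to the first one in [S]. *)
assert (K : defined proj_meet u v /\ defined proj_meet v w).
{ destruct H as [H|[[H1 H2]|[H1 H2]]]; [assumption | |].
  - split; [assumption|].
    change (sdef (proj1_sig (mul proj_meet u v)) (proj1_sig w)) in H2.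
    rewrite (proj_meetE H1) in H2; exact (sdef_mull H1 H2).
  - split; [|assumption].
    change (sdef (proj1_sig u) (proj1_sig (mul proj_meet v w))) in H2.
    rewrite (proj_meetE H1) in H2; exact (sdef_mulr H1 H2). }
destruct K as [H1 H2]; destruct (mul_assoc H1 H2) as (K1 & K2 & K3).
assert (L1 : defined proj_meet (mul proj_meet u v) w).
{ change (sdef (proj1_sig (mul proj_meet u v)) (proj1_sig w)).
  now rewrite (proj_meetE H1). }
assert (L2 : defined proj_meet u (mul proj_meet v w)).
{ change (sdef (proj1_sig u) (proj1_sig (mul proj_meet v w))).
  now rewrite (proj_meetE H2). }
repeat split; try assumption.
apply proj_sig_ext.
now rewrite (proj_meetE L1), (proj_meetE L2), (proj_meetE H1), (proj_meetE H2).
Qed.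

Lemma proj_local_meet_semilattice :
  @poset_is_local_meet_semilattice {u : S | proj u}
    (fun p q => le_l (proj1_sig p) (proj1_sig q)).
Proof.
exists proj_meet; split; [split; [exact proj_meet_semigroupoid | split] | split].
- intros p; destruct (proj_idem (proj2_sig p)) as [d E].
  split; [exact d | apply proj_sig_ext; now rewrite proj_meetE].
- intros p q H; destruct (proj_comm (proj2_sig p) (proj2_sig q) H) as [d E].
  split; [exact d | apply proj_sig_ext; now rewrite !proj_meetE].
- intros p q [d E]; rewrite (plus_proj (proj2_sig p)) in d, E.
  split; [exact d | apply proj_sig_ext; now rewrite proj_meetE].
- intros p q [d E]; unfold C_le_l; rewrite (plus_proj (proj2_sig p)).
  split; [exact d | now rewrite <- (proj_meetE d), E].
Qed.

Lemma locally_inductive_of_orders_coincide :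
  same_relation S le_l le_r -> @is_locally_inductive (C_cat plus star) le_l.
Proof.
intros [lr rl]; split; [|split; [|split]].
- split; [exact C_cat_category | split; [exact C_le_l_order | split]].
  + intros x y H; split.
    * now apply rl, C_le_r_star, lr.
    * now apply C_le_l_plus.
  + intros x y x' y'; apply C_le_l_mul.
- intros x e pe H.
  destruct (@C_cat_has_restrictions x e pe (lr _ _ H)) as (z & [Hz Ez] & U).
  exists z; split; [split; [now apply rl | assumption]|].
  intros z' [Hz' Ez']; apply U; split; [now apply lr | assumption].
- exact C_cat_has_corestrictions.
- exact proj_local_meet_semilattice.
Qed.

End Ehresmann.

Theorem theorem3p7 (S : semigroupoid) (plus star : S -> S) :
  is_ehresmann plus star ->
  (is_restriction plus star <->
   is_locally_inductive2 (C_cat plus star)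
     (C_le_l plus star) (C_le_r plus star)).
Proof.
intros HE; split.
- intros (_ & _ & _ & Hr & _).
  apply (restriction_axiom_iff_orders_coincide HE) in Hr.
  split; [exact Hr | now apply locally_inductive_of_orders_coincide].
- intros [Hs _].
  apply (restriction_axiom_iff_orders_coincide HE) in Hs.
  now destruct HE as (Hi & Hii & Hiii & _ & Hv).
Qed.
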